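(* If there exists a substitution method which solves every general linear programming problem $\max\{c^{\intercal}x : x\in\mathbb{R}^{n},\ Ax\leq b,\ x\geq\mathbf{0}\}$ (with $A\in\mathbb{R}^{m\times n}$, $b\in\mathbb{R}^{m}$, $c\in\mathbb{R}^{n}$) in strongly polynomial time, then Smale's 9th problem, dealing with linear programming, is resolved (affirmatively): there is a polynomial time algorithm over the real numbers which decides the feasibility of a linear system of inequalities $Ax\geq b$.
   Context: ''Solves'' means: on input $(A,b,c)$ the method either returns the maximum together with a point attaining it, or correctly reports that there is no maximum. ''Strongly polynomial time'' means that the number of elementary arithmetic operations and comparisons on real numbers is bounded by a polynomial in $m$ and $n$ only. Smale's 9th problem asks: is there a polynomial time algorithm over the real numbers (in the real-number model of computation, where each arithmetic operation and comparison has unit cost and the size of the input is its number of real entries) which decides, given $A\in\mathbb{R}^{m\times n}$ and $b\in\mathbb{R}^{m}$, whether there is $x\in\mathbb{R}^{n}$ with $Ax\geq b$? A ''substitution method'' is a procedure which works on the homogenized system $z\leq c^{\intercal}x+c_hh$, $c^{\intercal}x+c_hh\geq 0$, $Ax\leq bh$ (with an additional homogenization variable $h$ and $c_h=0$ initially), and, if needed, on the analogous homogenized system of the problem of maximizing $-b^{\intercal}y$ subject to $-A^{\intercal}y\leq -c$. At each step it replaces a remaining variable $x_j$ everywhere by the linear function of the other variables and $h$ obtained by solving for $x_j$ the equality associated with one inequality of the current system, and it replaces that inequality by the nonnegativity of this linear function. It ends with a backward substitution in a triangular linear system. *)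

(* Defs.v *)
From HB Require Import structures.
From mathcomp Require Import all_boot all_order all_algebra.
From mathcomp Require Import reals.

Set Implicit Arguments.
Unset Strict Implicit.
Unset Printing Implicit Defensive.

Import Order.TTheory GRing.Theory Num.Theory.
Local Open Scope ring_scope.

Section LinearProgramming.
Variables (R : realType) (m n : nat).
Implicit Types (A : 'M[R]_(m, n)) (b : 'cV[R]_m) (c x : 'cV[R]_n).

Definition objective c x : R := (c^T *m x) 0 0.

Definition lp_feasible A b x : Prop :=
  (forall i, (A *m x) i 0 <= b i 0) /\ (forall j, 0 <= x j 0).

(* [v] is the maximum of c^T x over {x | A x <= b, x >= 0}, attained at [x]. *)
Definition lp_max A b c (v : R) x : Prop :=
  [/\ lp_feasible A b x, objective c x = v &
      forall y, lp_feasible A b y -> objective c y <= v].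

End LinearProgramming.

(** A uniform real-number machine in the style of Blum, Shub and Smale,
    presented as a structured random access machine.  All data, indices
    included, are real numbers.  A program refers to finitely many registers and
    finitely many arrays by name; array cells are addressed indirectly, by two
    registers, which must contain natural numbers: otherwise the machine hangs,
    so that addressing provides neither a floor function nor an integrality
    test.
    As in the Blum-Shub-Smale model, a program may contain real constants.
    Division by 0 returns 0. *)

Inductive arith := Add | Sub | Mul | Div.
Inductive cmp := Le | Lt.

Inductive com (R : Type) : Type :=
| Skip
| Const (d : nat) (a : R)      (* r_d <- a *)
| Copy (d s : nat)             (* r_d <- r_s *)
| Op (o : arith) (d s t : nat) (* r_d <- r_s o r_t *)
| Read (d k i j : nat)         (* r_d <- k[r_i, r_j] *)
| Write (k i j s : nat)        (* k[r_i, r_j] <- r_s *)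
| Seq (P Q : com R)
| If (e : cmp) (s t : nat) (P Q : com R)   (* if r_s e r_t then P else Q *)
| While (e : cmp) (s t : nat) (P : com R). (* while r_s e r_t do P *)

Record state (R : Type) :=
  State { regs : nat -> R; cells : nat -> nat -> nat -> R }.

Section Machine.
Variable R : realType.
Implicit Types (s : state R) (P : com R).

Definition eval_arith (o : arith) (x y : R) : R :=
  match o with Add => x + y | Sub => x - y | Mul => x * y | Div => x / y end.

Definition eval_cmp (e : cmp) (x y : R) : bool :=
  match e with Le => x <= y | Lt => x < y end.

Definition set_reg s (d : nat) (a : R) : state R :=
  State (fun k => if k == d then a else regs s k) (cells s).

Definition is_address s (i : nat) : bool := regs s i \is a Num.nat.

Definition address s (i : nat) : nat := Num.truncn (regs s i).

Definition set_cell s (k i j : nat) (a : R) : state R :=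
  State (regs s) (fun k' i' j' =>
    if [&& k' == k, i' == i & j' == j] then a else cells s k' i' j').

(* The commands still to be executed, and the current state; the machine has
   halted when no command is left. *)
Definition config : Type := (seq (com R) * state R)%type.

Definition step (q : config) : config :=
  let: (K, s) := q in
  match K with
  | [::] => ([::], s)
  | Skip :: K => (K, s)
  | Const d a :: K => (K, set_reg s d a)
  | Copy d r :: K => (K, set_reg s d (regs s r))
  | Op o d r t :: K => (K, set_reg s d (eval_arith o (regs s r) (regs s t)))
  | Read d k i j :: K =>
      if is_address s i && is_address s j
      then (K, set_reg s d (cells s k (address s i) (address s j))) else q
  | Write k i j r :: K =>
      if is_address s i && is_address s j
      then (K, set_cell s k (address s i) (address s j) (regs s r)) else q
  | Seq P Q :: K => (P :: Q :: K, s)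
  | If e r t P Q :: K =>
      ((if eval_cmp e (regs s r) (regs s t) then P else Q) :: K, s)
  | While e r t P :: K =>
      (if eval_cmp e (regs s r) (regs s t) then P :: While e r t P :: K else K,
       s)
  end.

(* Unit cost for each arithmetic operation and each comparison.  Every iteration
   of a loop performs a comparison, so the number of all commands executed by a
   halting run is at most a constant, depending on the program only, times one
   plus this cost. *)
Definition cost (q : config) : nat :=
  match q.1 with
  | Op _ _ _ _ :: _ | If _ _ _ _ _ :: _ | While _ _ _ _ :: _ => 1%N
  | _ => 0%N
  end.

Definition run P s (t : nat) : config := iter t step ([:: P], s).

Definition halted (q : config) : bool := nilp q.1.

Definition operations P s (t : nat) : nat := (\sum_(k < t) cost (run P s k))%N.

Definition entry m n (A : 'M[R]_(m, n)) (i j : nat) : R :=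
  if (insub i, insub j) is (Some i', Some j') then A i' j' else 0.

Definition dim_regs (m n : nat) (k : nat) : R :=
  match k with 0 => m%:R | 1 => n%:R | _ => 0 end.

Definition lp_input m n (A : 'M[R]_(m, n)) (b : 'cV[R]_m) (c : 'cV[R]_n) :
    state R :=
  State (dim_regs m n)
    (fun k => match k with
              | 0 => entry A | 1 => entry b | 2 => entry c
              | _ => fun _ _ => 0
              end).

Definition feasibility_input m n (A : 'M[R]_(m, n)) (b : 'cV[R]_m) : state R :=
  State (dim_regs m n)
    (fun k => match k with
              | 0 => entry A | 1 => entry b
              | _ => fun _ _ => 0
              end).

(* [None] reports that there is no maximum. *)
Definition lp_output n s : option (R * 'cV[R]_n) :=
  if regs s 0 == 0 then None else Some (regs s 1, \col_(j < n) cells s 0 j 0).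

Definition accepts s : bool := regs s 0 != 0.

Definition lp_correct m n (A : 'M[R]_(m, n)) (b : 'cV[R]_m) (c : 'cV[R]_n)
    (o : option (R * 'cV[R]_n)) : Prop :=
  match o with
  | Some (v, x) => lp_max A b c v x
  | None => ~ exists v x, lp_max A b c v x
  end.

Definition solves_lp_in_strongly_polynomial_time P : Prop :=
  exists C d : nat,
  forall (m n : nat) (A : 'M[R]_(m, n)) (b : 'cV[R]_m) (c : 'cV[R]_n),
  (0 < m)%N -> (0 < n)%N ->
  exists t : nat,
  [/\ halted (run P (lp_input A b c) t),
      lp_correct A b c (lp_output n (run P (lp_input A b c) t).2) &
      (operations P (lp_input A b c) t <= C * (m + n) ^ d)%N].

(* m * n + m is the number of real entries of the input (A, b). *)
Definition decides_feasibility_in_polynomial_time P : Prop :=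
  exists C d : nat,
  forall (m n : nat) (A : 'M[R]_(m, n)) (b : 'cV[R]_m),
  (0 < m)%N -> (0 < n)%N ->
  exists t : nat,
  [/\ halted (run P (feasibility_input A b) t),
      accepts (run P (feasibility_input A b) t).2 <->
        exists x : 'cV[R]_n, forall i, b i 0 <= (A *m x) i 0 &
      (operations P (feasibility_input A b) t <= C * (m * n + m) ^ d)%N].

End Machine.

Section Substitution.
Variables (R : realType) (m n : nat).

(* A linear form in (z, x_1, ..., x_n, h) is a row vector, and a system is a
   matrix each of whose rows is a form required to be nonnegative. *)
Definition form : Type := 'rV[R]_(1 + (n + 1)).
Definition system : Type := 'M[R]_(1 + (1 + m), 1 + (n + 1)).

Definition var_col (j : 'I_n) : 'I_(1 + (n + 1)) := rshift 1 (lshift 1 j).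

(* z <= c^T x + c_h h,  c^T x + c_h h >= 0,  A x <= b h,  with c_h = 0 *)
Definition homogenized (A : 'M[R]_(m, n)) (b : 'cV[R]_m) (c : 'cV[R]_n) :
    system :=
  col_mx (row_mx (-1)%:M (row_mx c^T 0))
  (col_mx (row_mx 0 (row_mx c^T 0))
          (row_mx 0 (row_mx (- A) b))).

(* x_j as the linear form in the other variables obtained from f = 0 *)
Definition solved_for (j : 'I_n) (f : form) : form :=
  delta_mx 0 (var_col j) - (f 0 (var_col j))^-1 *: f.

(* The form g with x_j replaced by the form l *)
Definition replace_var (j : 'I_n) (l g : form) : form :=
  g - g 0 (var_col j) *: delta_mx 0 (var_col j) + g 0 (var_col j) *: l.

Definition substitute (S : system) (i : 'I_(1 + (1 + m))) (j : 'I_n) : system :=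
  let l := solved_for j (row i S) in
  \matrix_(k, q) (if k == i then l else replace_var j l (row k S)) 0 q.

(* Backward substitution in the triangular system formed by the equalities
   x_j = solved_for j (row i S) of the successive steps [ps].  Variables that
   have never been replaced keep the value given in [u]. *)
Fixpoint back_substitution (S : system) (ps : seq ('I_(1 + (1 + m)) * 'I_n))
    (u : 'cV[R]_(1 + (n + 1))) : 'cV[R]_(1 + (n + 1)) :=
  match ps with
  | [::] => u
  | (i, j) :: ps' =>
      let w := back_substitution (substitute S i j) ps' u in
      \col_k (if k == var_col j then (solved_for j (row i S) *m w) 0 0
              else w k 0)
  end.

(* The point obtained for h = 1 and z = v, remaining variables being 0 *)
Definition final_point (S : system) ps (v : R) : 'cV[R]_n :=
  let w := back_substitution S ps (col_mx v%:M (col_mx 0 1%:M)) in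
  \col_j w (var_col j) 0.

Definition holds p q (s : state R) (k : nat) (M : 'M[R]_(p, q)) : Prop :=
  forall (i : 'I_p) (j : 'I_q), cells s k i j = M i j.

(* From time [t] to time [t'], array [k] goes through the successive systems
   obtained from [S] by the steps [ps].  A nonzero entry in column [var_col j]
   means in particular that x_j has not been replaced yet. *)
Fixpoint performs (P : com R) (s : state R) (k t t' : nat) (S : system)
    (ps : seq ('I_(1 + (1 + m)) * 'I_n)) : Prop :=
  holds (run P s t).2 k S /\
  match ps with
  | [::] => t' = t
  | (i, j) :: ps' =>
      S i (var_col j) != 0 /\
      exists t1 : nat, (t < t1)%N /\ performs P s k t1 t' (substitute S i j) ps'
  end.

(* Between times [t] and [t'] the point [x] determined by the steps [ps] and the
   value [v] of z is available in array [k]. *)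
Definition back_substituted (P : com R) (s : state R) (k t t' : nat)
    (S : system) ps (v : R) (x : 'cV[R]_n) : Prop :=
  x = final_point S ps v /\
  exists t1 : nat, (t <= t1 <= t')%N /\ holds (run P s t1).2 k x.

End Substitution.

Definition dual_homogenized (R : realType) m n
    (A : 'M[R]_(m, n)) (b : 'cV[R]_m) (c : 'cV[R]_n) : system R n m :=
  homogenized (- A^T) (- c) (- b).

(* The program [P] keeps the current system in array [k] and the result of the
   backward substitution in array [l].  It works on the homogenized system
   first; a returned point [x] of value [v] either is obtained from it by
   backward substitution, or rests on a second phase, on the homogenized system
   of max {- b^T y : - A^T y <= - c, y >= 0}, whose backward substitution gives
   a point [y] attaining the maximum - v of that problem.  The choice of the
   steps and of the moment to stop is left to [P]. *)
Definition substitution_method (R : realType) (P : com R) : Prop :=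
  exists k l : nat,
  forall (m n : nat) (A : 'M[R]_(m, n)) (b : 'cV[R]_m) (c : 'cV[R]_n),
  (0 < m)%N -> (0 < n)%N ->
  let s := lp_input A b c in
  forall T : nat, halted (run P s T) ->
  exists t0 t1 ps,
  [/\ performs P s k t0 t1 (homogenized A b c) ps, (t1 <= T)%N &
      forall v x, lp_output n (run P s T).2 = Some (v, x) ->
        back_substituted P s l t1 T (homogenized A b c) ps v x \/
        exists t2 t3 qs y,
        [/\ (t1 < t2)%N, (t3 <= T)%N,
            performs P s k t2 t3 (dual_homogenized A b c) qs,
            back_substituted P s l t3 T (dual_homogenized A b c) qs (- v) y &
            lp_max (- A^T) (- c) (- b) (- v) y]].

Definition smale_ninth_problem (R : realType) : Prop :=
  exists Q : com R, decides_feasibility_in_polynomial_time Q.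

(* Main.v *)
Require Import Defs.
From mathcomp Require Import all_boot all_order all_algebra.
From mathcomp Require Import boolp reals.

(** A system [A x >= b] in free variables is feasible iff the linear program
    maximizing [0] subject to [- A u + A w <= - b] and [u, w >= 0] has a
    maximum: write [x = u - w], and note that a constant objective attains its
    maximum at every feasible point ([lp_max_split_iff]).  So feasibility is
    decided by a linear programming solver preceded by a program that rewrites
    the input [(A, b)] into [([- A, A], - b, 0)].

    That program, [split_variables], works in place: it visits each entry of
    [A] once, which costs [O (m n + m)] operations, and it resets its scratch
    registers, because the solver is only known to be correct when started on
    the exact input state ([exec_split_variables]).  The solver then runs on
    [m] inequalities in [2 n] variables, and [m + 2 n <= 2 (m n + m)], so that
    its bound in [m] and [n] becomes a bound in the number of real entries. *)

Set Implicit Arguments.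
Unset Strict Implicit.
Unset Printing Implicit Defensive.

Import Order.TTheory GRing.Theory Num.Theory.
Local Open Scope ring_scope.

(** * Feasibility as a linear program *)

Section VariableSplitting.
Variables (R : realType) (m n : nat).
Implicit Types (A : 'M[R]_(m, n)) (b : 'cV[R]_m).

Lemma lp_feasible_split A b (u w : 'cV[R]_n) :
  lp_feasible (row_mx (- A) A) (- b) (col_mx u w) <->
  [/\ forall i, b i 0 <= (A *m (u - w)) i 0,
      forall j, 0 <= u j 0 & forall j, 0 <= w j 0].
Proof.
have E i : ((row_mx (- A) A *m col_mx u w) i 0 <= (- b) i 0) =
           (b i 0 <= (A *m (u - w)) i 0).
  rewrite mul_row_col mulNmx addrC -opprB -mulmxBr.
  by rewrite [leLHS]mxE [leRHS]mxE lerN2.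
split=> [[le_b ge0] | [le_b u_ge0 w_ge0]].
  split=> [i|j|j]; first by rewrite -E.
    by have := ge0 (lshift n j); rewrite col_mxEu.
  by have := ge0 (rshift n j); rewrite col_mxEd.
split=> [i|j]; first by rewrite E.
by case: (split_ordP j) => k ->; rewrite ?col_mxEu ?col_mxEd.
Qed.

(** The objective is 0, so a maximum is the same as a feasible point. *)
Lemma lp_max_split_iff A b :
  (exists v x, lp_max (row_mx (- A) A) (- b) 0 v x) <->
  exists x : 'cV[R]_n, forall i, b i 0 <= (A *m x) i 0.
Proof.
have obj0 (x : 'cV[R]_(n + n)) : objective 0 x = 0.
  by rewrite /objective trmx0 mul0mx mxE.
split=> [[v [x [+ _ _]]] | [x le_b]].
  rewrite -(vsubmxK x) => /lp_feasible_split[le_b _ _].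
  by exists (usubmx x - dsubmx x).
(* the positive and negative parts of x *)
pose u := map_mx (Num.max 0) x; pose w := map_mx (Num.max 0) (- x).
have xE : u - w = x.
  apply/matrixP => i j; rewrite !mxE.
  have /orP[x0|x0] := le_total 0 (x i j).
    by rewrite max_r // max_l ?subr0 // oppr_le0.
  by rewrite max_l // max_r ?sub0r ?opprK // oppr_ge0.
exists 0, (col_mx u w); split=> [||y _]; rewrite ?obj0 //.
apply/lp_feasible_split; rewrite xE; split=> // j;
  by rewrite mxE le_max lexx.
Qed.

End VariableSplitting.

(** * Runs and their cost *)

Section Execution.
Variable R : realType.
Implicit Types (c : com R) (s : state R).

Definition reaches (q q' : config R) (N : nat) : Prop :=
  exists t, iter t (@step R) q = q' /\
            (\sum_(k < t) cost (iter k (@step R) q) = N)%N.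

Lemma reaches_refl q : reaches q q 0.
Proof. by exists 0; rewrite big_ord0. Qed.

Lemma reaches_trans q1 q2 q3 N N' :
  reaches q1 q2 N -> reaches q2 q3 N' -> reaches q1 q3 (N + N').
Proof.
move=> [t [tE <-]] [t' [t'E <-]]; exists (t' + t)%N.
rewrite iterD tE t'E; split=> //.
rewrite addnC big_split_ord /=; congr addn.
by apply: eq_bigr => k _; rewrite addnC iterD tE.
Qed.

Lemma reaches_step q q' N :
  reaches (step q) q' N -> reaches q q' (cost q + N).
Proof.
by apply: reaches_trans; exists 1; rewrite big_ord_recl big_ord0 addn0.
Qed.

(** The pending commands [K] are arbitrary so that executions compose. *)
Definition exec c s s' (N : nat) : Prop :=
  forall K, reaches (c :: K, s) (K, s') N.

Lemma exec_eq c s s1 s2 N : exec c s s1 N -> s1 = s2 -> exec c s s2 N.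
Proof. by move=> ex <-. Qed.

Lemma exec_seq c1 c2 s1 s2 s3 N1 N2 :
  exec c1 s1 s2 N1 -> exec c2 s2 s3 N2 ->
  exec (Seq c1 c2) s1 s3 (N1 + N2).
Proof.
move=> e1 e2 K; apply: reaches_step.
by apply: reaches_trans (e1 _) (e2 K).
Qed.

Lemma run_seq c1 c2 s1 s2 N t : exec c1 s1 s2 N ->
  exists T, run (Seq c1 c2) s1 T = run c2 s2 t /\
            operations (Seq c1 c2) s1 T = (N + operations c2 s2 t)%N.
Proof.
move=> e1.
have run2 : reaches ([:: c2], s2) (run c2 s2 t) (operations c2 s2 t).
  by exists t.
apply: (@reaches_step ([:: Seq c1 c2], s1)).
exact: reaches_trans (e1 _) run2.
Qed.

(** The states [S k] describe the machine after [k] rounds; the test costs 1 in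
    each round and 1 more when it fails. *)
Lemma exec_for (S : nat -> state R) c (i b n N : nat) :
  (forall k, (k <= n)%N -> regs (S k) i = k%:R /\ regs (S k) b = n%:R) ->
  (forall k, (k < n)%N -> exec c (S k) (S k.+1) N) ->
  exec (While Lt i b c) (S 0) (S n) (n * N.+1 + 1).
Proof.
move=> counter body K.
have iterations k : (k <= n)%N ->
    reaches (While Lt i b c :: K, S 0) (While Lt i b c :: K, S k) (k * N.+1).
  elim: k => [|k IHk] ltkn; first exact: reaches_refl.
  rewrite mulSnr; apply: reaches_trans (IHk (ltnW ltkn)) _.
  have [iE bE] := counter k (ltnW ltkn).
  by apply: reaches_step; rewrite /= iE bE ltr_nat ltkn; apply: body.
apply: reaches_trans (iterations n (leqnn n)) _.
have [iE bE] := counter n (leqnn n).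
apply: reaches_step; rewrite /= iE bE ltxx; exact: reaches_refl.
Qed.

(** Finitely many registers are kept as an explicit sequence, so that the
    effect of a straight-line program is found by computation. *)
Definition seq_state (rs : seq R) (mem : nat -> nat -> nat -> R) : state R :=
  State (nth 0 rs) mem.

Lemma set_seq_reg rs mem d a :
  set_reg (seq_state rs mem) d a = seq_state (set_nth 0 rs d a) mem.
Proof.
by congr State; apply: funext => k; rewrite nth_set_nth.
Qed.

Lemma exec_const rs mem d a :
  exec (Const d a) (seq_state rs mem) (seq_state (set_nth 0 rs d a) mem) 0.
Proof.
by move=> K; apply: reaches_step; rewrite /= set_seq_reg; apply: reaches_refl.
Qed.

Lemma exec_op rs mem o d r t :
  exec (Op R o d r t) (seq_state rs mem)
    (seq_state (set_nth 0 rs d (eval_arith o rs`_r rs`_t)) mem) 1.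
Proof.
by move=> K; apply: reaches_step; rewrite /= set_seq_reg; apply: reaches_refl.
Qed.

Lemma exec_read rs mem d k i j p q :
  rs`_i = p%:R -> rs`_j = q%:R ->
  exec (Read R d k i j) (seq_state rs mem)
    (seq_state (set_nth 0 rs d (mem k p q)) mem) 0.
Proof.
move=> iE jE K; apply: reaches_step.
rewrite /= /is_address /address /= iE jE !natr_nat !natrK set_seq_reg /=.
exact: reaches_refl.
Qed.

Lemma exec_write rs mem k i j r p q :
  rs`_i = p%:R -> rs`_j = q%:R ->
  exec (Write R k i j r) (seq_state rs mem)
    (seq_state rs (fun k' p' q' =>
       if [&& k' == k, p' == p & q' == q] then rs`_r else mem k' p' q')) 0.
Proof.
move=> iE jE K; apply: reaches_step.
rewrite /= /is_address /address /= iE jE !natr_nat !natrK /=.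
exact: reaches_refl.
Qed.

End Execution.

(** * Rewriting the input in place *)

Section Rewriting.
Variable R : realType.

(** An entry is copied to the right half before its negation overwrites it. *)
Definition split_entry : com R :=
  Seq (Read R 5 0 2 3)
 (Seq (Op R Add 7 3 1)
 (Seq (Write R 0 2 7 5)
 (Seq (Op R Defs.Sub 5 6 5)
 (Seq (Write R 0 2 3 5)
 (Seq (Const 5 0)
 (Seq (Const 7 0)
      (Op R Add 3 3 4))))))).

Definition split_row : com R :=
  Seq (Read R 5 1 2 6)
 (Seq (Op R Defs.Sub 5 6 5)
 (Seq (Write R 1 2 6 5)
 (Seq (Const 5 0)
 (Seq (While Lt 3 1 split_entry)
 (Seq (Const 3 0)
      (Op R Add 2 2 4)))))).

(** Registers 0 and 1 hold the dimensions, 2 and 3 the current row and column,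
    4 the increment 1, and 6 the constant 0; registers 5 and 7 are scratch. *)
Definition split_variables : com R :=
  Seq (Const 4 1)
 (Seq (While Lt 2 0 split_row)
 (Seq (Const 2 0)
 (Seq (Const 4 0)
      (Op R Add 1 1 1)))).

Lemma entry_out m n (A : 'M[R]_(m, n)) i j :
  (m <= i)%N || (n <= j)%N -> entry A i j = 0.
Proof.
rewrite /entry; case: insubP => [i' + _ | //]; rewrite ltnNge => /negbTE-> /=.
by case: insubP => [j' + _ | //]; rewrite ltnNge => /negbTE->.
Qed.

Lemma entryE m n (A : 'M[R]_(m, n)) i j (ltim : (i < m)%N) (ltjn : (j < n)%N) :
  entry A i j = A (Ordinal ltim) (Ordinal ltjn).
Proof. by rewrite /entry !insubT. Qed.

Lemma entryN m n (A : 'M[R]_(m, n)) i j : entry (- A) i j = - entry A i j.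
Proof.
have [out|] := boolP ((m <= i)%N || (n <= j)%N).
  by rewrite !entry_out ?oppr0.
by rewrite negb_or -!ltnNge => /andP[ltim ltjn]; rewrite !entryE mxE.
Qed.

Lemma entry0 m n i j : entry (0 : 'M[R]_(m, n)) i j = 0.
Proof.
have [/entry_out-> //|] := boolP ((m <= i)%N || (n <= j)%N).
by rewrite negb_or -!ltnNge => /andP[ltim ltjn]; rewrite !entryE mxE.
Qed.

Lemma entry_row_mx m n1 n2 (A : 'M[R]_(m, n1)) (B : 'M[R]_(m, n2)) i j :
  entry (row_mx A B) i j =
    if (j < n1)%N then entry A i j else entry B i (j - n1).
Proof.
have [lemi|ltim] := leqP m i; first by rewrite !entry_out ?lemi // if_same.
have [ltj1|le1j] := ltnP j n1.
  rewrite !entryE ?(ltn_addr _ ltj1) // => ltj.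
  rewrite (_ : Ordinal ltj = lshift n2 (Ordinal ltj1)) ?row_mxEl //.
  exact: val_inj.
have [le2j|ltj2] := leqP n2 (j - n1).
  by rewrite !entry_out ?le2j ?orbT // -leq_subRL ?le2j ?orbT.
rewrite !entryE -?ltn_subLR // => ltj.
rewrite (_ : Ordinal ltj = rshift n1 (Ordinal ltj2)) ?row_mxEr //.
by apply: val_inj; rewrite /= subnKC.
Qed.

Section Invariant.
Variables (m n : nat) (A : 'M[R]_(m, n)) (b : 'cV[R]_m).

Definition split_regs (i j : nat) : seq R :=
  [:: m%:R; n%:R; i%:R; j%:R; 1; 0; 0; 0].

(** The memory when the traversal of [A] is about to visit column [j] of row
    [i].  Visiting column [q] settles the columns [q] and [n + q] of the new
    matrix; hence two intervals of columns in the current row.  The counter [k]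
    for [b] is separate because it is advanced before its row is traversed. *)
Definition split_cells (i j k : nat) (a p q : nat) : R :=
  match a with
  | 0 => if (p < i)%N || (p == i) && ((q < j)%N || (n <= q < n + j)%N)
         then entry (row_mx (- A) A) p q else entry A p q
  | 1 => if (p < k)%N then - entry b p q else entry b p q
  | _ => 0
  end.

Definition split_state i j k := seq_state (split_regs i j) (split_cells i j k).

Lemma split_cells_unvisited i j k : (j < n)%N ->
  split_cells i j k 0 i j = entry A i j.
Proof. by move=> ltjn; rewrite /= !ltnn eqxx leqNgt ltjn. Qed.

Lemma split_cells_entryS i j k : (j < n)%N ->
  split_cells i j.+1 k = fun a p q =>
    if [&& a == 0, p == i & q == j]%N then - entry A i j else
    if [&& a == 0, p == i & q == n + j]%N then entry A i j else
    split_cells i j k a p q.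
Proof.
move=> ltjn; apply: funext => -[|a]; apply: funext => p; apply: funext => q //=.
have [->|_] //= := eqVneq p i.
rewrite ltnn /= !ltnS addnS ltnS (leq_eqVlt q j) (leq_eqVlt q (n + j)).
have [->|_] /= := eqVneq q j; first by rewrite entry_row_mx ltjn entryN.
have [->|_] //= := eqVneq q (n + j)%N.
by rewrite leq_addr orbT entry_row_mx ltnNge leq_addr addKn.
Qed.

Lemma exec_split_entry i j k : (j < n)%N ->
  exec split_entry (split_state i j k) (split_state i j.+1 k) 3.
Proof.
move=> ltjn; rewrite (_ : 3 = 0 + (1 + (0 + (1 + (0 + (0 + (0 + 1)))))))%N //.
apply: exec_seq; first exact: (@exec_read _ _ _ _ _ _ _ i j).
rewrite split_cells_unvisited //.
apply: exec_seq; first exact: exec_op.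
apply: exec_seq.
  by apply: (@exec_write _ _ _ _ _ _ _ i (n + j)) => //=; rewrite natrD addrC.
apply: exec_seq; first exact: exec_op.
apply: exec_seq; first exact: (@exec_write _ _ _ _ _ _ _ i j).
apply: exec_seq; first exact: exec_const.
apply: exec_seq; first exact: exec_const.
apply: exec_eq (exec_op _ _ _ _ _ _) _.
by rewrite /split_state split_cells_entryS //= sub0r natr1.
Qed.

Lemma split_cells_rhs0 i k : (k < m)%N ->
  split_cells i 0 k.+1 = fun a p q =>
    if [&& a == 1, p == k & q == 0]%N then - entry b k 0 else
    split_cells i 0 k a p q.
Proof.
move=> ltkm; apply: funext => -[|[|a]]; apply: funext => p;
  apply: funext => q //=.
rewrite ltnS leq_eqVlt; have [->|//] := eqVneq p k.
case: q => [|q] //=; rewrite ltnn.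
by rewrite entry_out ?oppr0 // orbT.
Qed.

(** From column [2 n] on, the old and the new matrix both read as 0, so that
    the two descriptions of a completed row agree there too. *)
Lemma split_cells_rowS i k : split_cells i n k = split_cells i.+1 0 k.
Proof.
apply: funext => -[|a]; apply: funext => p; apply: funext => q //=.
rewrite addn0 (ltnNge q n) andbN andbF orbF ltnS (leq_eqVlt p i).
have [->|_] /= := eqVneq p i; last by rewrite orbF.
rewrite ltnn /=.
have [leq|ltq] := leqP (n + n) q; last by rewrite andbT orNb.
rewrite entry_out ?leq ?orbT // entry_out ?if_same //.
by rewrite (leq_trans (leq_addr n n) leq) orbT.
Qed.

Lemma exec_split_row i : (i < m)%N ->
  exec split_row (split_state i 0 i) (split_state i.+1 0 i.+1) (4 * n + 3).
Proof.
move=> ltim.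
rewrite (_ : 4 * n + 3 = 0 + (1 + (0 + (0 + (n * 4 + 1 + (0 + 1))))))%N; last first.
  by rewrite mulnC !add0n !addn1 add1n addn3.
apply: exec_seq; first exact: (@exec_read _ _ _ _ _ _ _ i 0).
rewrite [split_cells i 0 i 1 i 0]/= ltnn.
apply: exec_seq; first exact: exec_op.
apply: exec_seq; first exact: (@exec_write _ _ _ _ _ _ _ i 0).
apply: exec_seq; first exact: exec_const.
rewrite [X in exec _ X](_ : _ = split_state i 0 i.+1); last first.
  by rewrite /split_state split_cells_rhs0 //= sub0r.
apply: exec_seq.
  apply: (exec_for (S := fun j => split_state i j i.+1)) => // j ltjn.
  exact: exec_split_entry.
apply: exec_seq; first exact: exec_const.
apply: exec_eq (exec_op _ _ _ _ _ _) _.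
by rewrite /split_state split_cells_rowS /= natr1.
Qed.

Lemma exec_split_variables :
  exec split_variables (feasibility_input A b)
    (lp_input (row_mx (- A) A) (- b) 0) (m * (4 * n + 4) + 2).
Proof.
rewrite (_ : m * _ + 2 = 0 + (m * (4 * n + 3).+1 + 1 + (0 + (0 + 1))))%N; last first.
  by rewrite !add0n -addnS !addn1 addn2.
have -> : feasibility_input A b =
    seq_state [:: m%:R; n%:R; 0; 0; 0; 0; 0; 0] (split_cells 0 0 0).
  congr State.
    by apply: funext => -[|[|[|[|[|[|[|[|k]]]]]]]] //=; rewrite nth_nil.
  apply: funext => -[|[|k]]; apply: funext => p; apply: funext => q //=.
  by rewrite addn0 (ltnNge q n) andbN andbF.
apply: exec_seq; first exact: exec_const.
apply: exec_seq.
  apply: (exec_for (S := fun i => split_state i 0 i)) => // i ltim.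
  exact: exec_split_row.
apply: exec_seq; first exact: exec_const.
apply: exec_seq; first exact: exec_const.
apply: exec_eq (exec_op _ _ _ _ _ _) _.
congr State.
  apply: funext => -[|[|[|[|[|[|[|[|k]]]]]]]] //=; first by rewrite natrD.
  by rewrite nth_nil.
apply: funext => -[|[|[|k]]]; apply: funext => p; apply: funext => q //=.
- rewrite addn0 (ltnNge q n) andbN andbF orbF.
  by case: ltnP => // lemp; rewrite !entry_out ?lemp.
- by rewrite entryN; case: ltnP => // lemp; rewrite entry_out ?lemp ?oppr0.
- by rewrite entry0.
Qed.

End Invariant.
End Rewriting.

(** * The reduction *)

(** The number of entries bounds [m + 2 n] up to the factor 2 and the cost of
    the rewriting up to the factor 6; the exponent [d.+1] leaves room for that
    linear cost when [d] is 0. *)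
Lemma split_cost_bound (m n C d : nat) : (0 < m)%N -> (0 < n)%N ->
  (m * (4 * n + 4) + 2 + C * (m + (n + n)) ^ d
     <= (6 + C * 2 ^ d) * (m * n + m) ^ d.+1)%N.
Proof.
move=> m_gt0 n_gt0; set N := (m * n + m)%N.
have N_gt0 : (0 < N)%N by rewrite addn_gt0 m_gt0 orbT.
have leX : (N ^ d <= N ^ d.+1)%N by rewrite leq_pexp2l.
have leN : (N <= N ^ d.+1)%N by rewrite -[leqLHS]expn1 leq_pexp2l.
rewrite mulnDl leq_add //.
  apply: leq_trans (leq_mul (leqnn 6) leN).
  have -> : (m * (4 * n + 4) = 4 * N)%N.
    by rewrite mulnDr mulnCA (mulnC m 4) -mulnDr.
  by rewrite -[6%N]/(4 + 2)%N mulnDl leq_add2l leq_pmulr.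
rewrite -mulnA leq_mul2l; apply/orP; right.
apply: leq_trans (leq_mul (leqnn _) leX); rewrite -expnMn.
case: d {leX leN} => // d; rewrite leq_exp2r //.
rewrite addnC addnn -mul2n mulnDr leq_add ?leq_pmull //.
by rewrite leq_mul2l leq_pmull.
Qed.

Theorem corollary2p1 (R : realType) :
  (exists P : com R,
      substitution_method P /\ solves_lp_in_strongly_polynomial_time P) ->
  smale_ninth_problem R.
Proof.
move=> [P [_ [C [d solves]]]].
exists (Seq (split_variables R) P); exists (6 + C * 2 ^ d)%N, d.+1.
move=> m n A b m_gt0 n_gt0.
have [|t [halts correct cheap]] := solves _ _ (row_mx (- A) A) (- b) 0 m_gt0.
  by rewrite addn_gt0 n_gt0.
have [T [runE opE]] := run_seq P t (exec_split_variables A b).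
exists T; rewrite runE opE; split=> //; last first.
  apply: leq_trans (split_cost_bound C d m_gt0 n_gt0).
  by rewrite leq_add2l.
rewrite -lp_max_split_iff; move: correct; rewrite /lp_output /accepts.
case: eqP => [_ no_max|_ max]; first by split.
by split=> // _; eexists; eexists; apply: max.
Qed.
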